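(* Let $N\ge M\ge 2$ be integers, $a_1,\dots,a_N\ge 1$ integers, and let $\mathcal T=(\mathcal T_m)_{m=1}^M$ be a tuple partition of $(1,\dots,N)$. For every probability tensor $P\in\Sigma\subset\mathbb R^{a_1\times\cdots\times a_N}$, $$\mathrm{KL}(P\,|\,P_{\#\mathcal T}) = H(P)-\sum_{m=1}^M H_m(P),\qquad H_m(P):=H(P_{\#\mathcal T_m}),$$ and each function $H_m$ ($m=1,\dots,M$) is continuous and convex in $P\in\Sigma$. Consequently, for every $\varepsilon\ge 0$, every cost tensor $C\in\mathbb R^{a_1\times\cdots\times a_N}$ and every collection $\mu=(\mu_n)_{n=1}^N$ of probability vectors $\mu_n\in\mathbb R^{a_n}$, $$\inf_{P\in U(\mu)}\langle C,P\rangle+\varepsilon\,\mathrm{KL}(P\,|\,P_{\#\mathcal T})=\inf_{P\in U(\mu)}\Big(\langle C,P\rangle+\varepsilon H(P)\Big)-\varepsilon\sum_{m=1}^M H_m(P),$$ and this is a difference of convex programming problem: the set $U(\mu)$ is convex, and the objective is the difference of the convex functions $P\mapsto\langle C,P\rangle+\varepsilon H(P)$ and $P\mapsto\varepsilon\sum_{m=1}^M H_m(P)$.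
   Context: A tensor is a probability tensor if its entries are nonnegative and sum to $1$; $\Sigma$ is the set of probability tensors in $\mathbb R^{a_1\times\cdots\times a_N}$. $U(\mu)\subset\Sigma$ is the set of nonnegative tensors whose $N$ one-dimensional marginals are $\mu_1,\dots,\mu_N$ (the $n$-th marginal is obtained by summing over all dimensions except the $n$-th). $\langle\cdot,\cdot\rangle$ is the entrywise (Frobenius) inner product. Tuple partition: a sequence $\mathcal T=(\mathcal T_m)_{m=1}^M$ of nonempty disjoint tuples whose concatenation, in this order, is $(1,\dots,N)$ (so each $\mathcal T_m$ is a block of consecutive integers). Marginal tensors: $P_{\#\mathcal T_m}$ is the tensor obtained from $P$ by summing over all dimensions not in $\mathcal T_m$, and $P_{\#\mathcal T}=P_{\#\mathcal T_1}\otimes\cdots\otimes P_{\#\mathcal T_M}\in\mathbb R^{a_1\times\cdots\times a_N}$ is the tensor product of the marginal tensors. Negative entropy: $H(P)=\langle P,\log P\rangle$ (entrywise logarithm, $0\log 0=0$), for probability tensors of any shape. Kullback-Leibler divergence: $\mathrm{KL}(P|Q)=\langle P,\log(P/Q)\rangle$ (entrywise division, with the same convention) if $P$ is absolutely continuous with respect to $Q$, and $+\infty$ otherwise. *)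

(* Defs.v *)
From HB Require Import structures.
From mathcomp Require Import all_boot all_order all_algebra.
From mathcomp Require Import all_classical all_reals all_analysis.

Set Implicit Arguments.
Unset Strict Implicit.
Unset Printing Implicit Defensive.

Import Order.TTheory GRing.Theory Num.Theory.
Import numFieldNormedType.Exports.

Local Open Scope classical_set_scope.
Local Open Scope ring_scope.

(* Multi-indices of a tensor of shape d_0 x ... x d_(k-1); a tensor with
   entries in R is a function [midx d -> R]. *)
Notation midx d := {dffun forall j, 'I_(d j)}.

Definition prob_tensor (R : realType) (I : finType) : set (I -> R) :=
  [set P | (forall i, 0 <= P i) /\ \sum_i P i = 1].
Arguments prob_tensor : clear implicits.

Definition inner (R : realType) (I : finType) (C P : I -> R) : R :=
  \sum_i C i * P i.

(* 0 log 0 = 0 holds because the factor P i vanishes. *)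
Definition negentropy (R : realType) (I : finType) (P : I -> R) : R :=
  \sum_i P i * ln (P i).

Definition abs_cont (R : realType) (I : finType) (P Q : I -> R) : Prop :=
  forall i, Q i = 0 -> P i = 0.

(* When P is absolutely continuous with respect to Q, the terms with Q i = 0
   have P i = 0, so they vanish whatever the value of P i / Q i. *)
Definition KL (R : realType) (I : finType) (P Q : I -> R) : \bar R :=
  if `[< abs_cont P Q >] then (\sum_i P i * ln (P i / Q i))%:E else +oo%E.

(* The tuple (1, ..., N) is [enum 'I_N], with dimensions numbered from 0. *)
Definition tuple_partition (N M : nat) (T : M.-tuple (seq 'I_N)) : Prop :=
  [/\ forall m, tnth T m != [::],
      forall m m', m != m' ->
        forall n, n \in tnth T m -> n \notin tnth T m' &
      flatten T = enum 'I_N].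

Definition subshape (N : nat) (a : 'I_N -> nat) (t : seq 'I_N) :
    'I_(size t) -> nat :=
  fun j => a (tnth (in_tuple t) j).
Arguments subshape {N} a t j.

Definition subidx (N : nat) (a : 'I_N -> nat) (t : seq 'I_N)
    (i : midx a) : midx (subshape a t) :=
  [ffun j : 'I_(size t) => i (tnth (in_tuple t) j) : 'I_(subshape a t j)].
Arguments subidx {N a} t i.

Definition marginal (R : realType) (N : nat) (a : 'I_N -> nat)
    (t : seq 'I_N) (P : midx a -> R) : midx (subshape a t) -> R :=
  fun j => \sum_(i : midx a | subidx t i == j) P i.
Arguments marginal {R N a} t P _.

(* Tensor product of one tensor per block. When T is a tuple partition, a
   multi-index of shape a is the concatenation of its restrictions to the
   blocks, so the entry at i is the product of the blockwise entries. *)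
Definition tensor_prod (R : realType) (N M : nat) (a : 'I_N -> nat)
    (T : M.-tuple (seq 'I_N))
    (Q : forall m : 'I_M, midx (subshape a (tnth T m)) -> R) : midx a -> R :=
  fun i => \prod_(m < M) Q m (subidx (tnth T m) i).

Definition marginal_prod (R : realType) (N M : nat) (a : 'I_N -> nat)
    (T : M.-tuple (seq 'I_N)) (P : midx a -> R) : midx a -> R :=
  tensor_prod (fun m => marginal (tnth T m) P).

Definition block_negentropy (R : realType) (N M : nat) (a : 'I_N -> nat)
    (T : M.-tuple (seq 'I_N)) (m : 'I_M) (P : midx a -> R) : R :=
  negentropy (marginal (tnth T m) P).

Definition marginal1 (R : realType) (N : nat) (a : 'I_N -> nat)
    (n : 'I_N) (P : midx a -> R) : 'I_(a n) -> R :=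
  fun j => \sum_(i : midx a | i n == j) P i.
Arguments marginal1 {R N a} n P _.

Definition couplings (R : realType) (N : nat) (a : 'I_N -> nat)
    (mu : forall n : 'I_N, 'I_(a n) -> R) : set (midx a -> R) :=
  [set P | (forall i, 0 <= P i) /\ forall n, marginal1 n P =1 mu n].

(* [convex_function] does not require its domain to be convex. *)
Definition convex_on (R : realType) (I : finType)
    (D : set (I -> R)) (f : (I -> R) -> R) : Prop :=
  @convex_set R (I -> R^o) D /\ @convex_function R (I -> R^o) D f.

(* [{ptws I -> R}] carries the product topology, i.e. for finite I the usual
   topology of the Euclidean space R^I. *)
Definition continuous_on (R : realType) (I : finType)
    (D : set (I -> R)) (f : (I -> R) -> R) : Prop :=
  {within (D : set {ptws I -> R}), continuous (f : {ptws I -> R} -> R)}.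

(* Main.v *)
Require Import Defs.
From HB Require Import structures.
From mathcomp Require Import all_boot all_order all_algebra.
From mathcomp Require Import all_classical all_reals all_analysis.
From mathcomp Require Import ring lra.

Set Implicit Arguments.
Unset Strict Implicit.
Unset Printing Implicit Defensive.

Import Order.TTheory GRing.Theory Num.Theory.
Import numFieldNormedType.Exports.

Local Open Scope classical_set_scope.
Local Open Scope ring_scope.

(* Every entry of a nonnegative tensor P is at most the corresponding entry of
   each of its marginals, so P is absolutely continuous with respect to the
   product of its marginals; where P is positive, the logarithm of the product
   splits, and summing P * log of a marginal over the fibres of the restriction
   map gives the negative entropy of that marginal. Convexity and continuity
   reduce to those of x log x, since marginals are linear in P: x log x lies
   above its tangent lines, and |x log x| <= 2 sqrt x near 0. *)

(** * Convexity and continuity of x log x *)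

Section xlnx.
Variable R : realType.
Implicit Types x y z p q : R.

(** This is ln u <= u - 1 at u = z / x, multiplied by x. At x = 0 the left side collapses to - z. *)
Lemma xlnx_ge_tangent x z : 0 <= x -> 0 < z ->
  z * ln z + (1 + ln z) * (x - z) <= x * ln x.
Proof.
rewrite le_eqVlt => /predU1P[<-|x0] z0; first by rewrite mul0r; nra.
have : ln (z / x) <= z / x - 1.
  have zx0 : -1 < z / x - 1 by rewrite ltrBrDr addNr divr_gt0.
  by have := le_ln1Dx zx0; rewrite addrC subrK.
rewrite ln_div ?posrE// -(ler_pM2l x0) !mulrBr mulr1 mulrCA divff ?gt_eqF//.
by nra.
Qed.

(** Average the tangent inequalities at the mean z: the first-order terms cancel because p (x - z) +
    q (y - z) = 0. If z = 0 there is no tangent, but then p x and q y both vanish. *)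
Lemma xlnx_convex p q x y : 0 <= p -> 0 <= q -> p + q = 1 ->
  0 <= x -> 0 <= y ->
  (p * x + q * y) * ln (p * x + q * y) <= p * (x * ln x) + q * (y * ln y).
Proof.
move=> p0 q0 pq1 x0 y0; set z := p * x + q * y.
have : 0 <= z by rewrite addr_ge0// mulr_ge0.
rewrite le_eqVlt => /predU1P[z0|z0].
  rewrite -z0 mul0r; have /eqP : p * x + q * y = 0 by [].
  rewrite paddr_eq0 ?mulr_ge0// => /andP[/eqP px /eqP qy].
  by rewrite !mulrA px qy !mul0r addr0.
have := lerD (ler_wpM2l p0 (xlnx_ge_tangent x0 z0))
             (ler_wpM2l q0 (xlnx_ge_tangent y0 z0)).
apply: le_trans; rewrite le_eqVlt; apply/orP; left; apply/eqP.
have -> : q = 1 - p by rewrite -pq1 addrAC subrr add0r.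
have -> : z = p * x + (1 - p) * y.
  by rewrite -pq1 addrAC subrr add0r.
by ring.
Qed.

(* With x = s^2, ln s = - ln (1/s) >= - 1/s. *)
Lemma norm_xlnx_le x : 0 <= x <= 1 -> `|x * ln x| <= 2 * Num.sqrt x.
Proof.
move=> /andP[]; rewrite le_eqVlt => /predU1P[<- _|x0 x1].
  by rewrite mul0r normr0 sqrtr0 mulr0.
set s := Num.sqrt x; have s0 : 0 < s by rewrite sqrtr_gt0.
have xE : x = s ^+ 2 by rewrite sqr_sqrtr// ltW.
have ls : - s^-1 <= ln s.
  have := ln_sublinear (_ : 0 < s^-1); rewrite invr_gt0 => /(_ s0).
  by rewrite lnV ?posrE// lerNl => /ltW.
rewrite ler0_norm; last by rewrite mulr_ge0_le0 ?ln_le0// ltW.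
rewrite xE lnXn// -mulrN -mulNrn mulrnAr -mulr_natl ler_pM2l//.
rewrite expr2 -mulrA ger_pMr// -(mulfV (lt0r_neq0 s0)) ler_pM2l//.
by rewrite lerNl.
Qed.

(* Holds on the whole line because [ln x] is 0 for [x <= 0]. *)
Lemma continuous_xlnx : continuous (fun x : R => x * ln x).
Proof.
move=> x; have [x0|x0|->] := ltgtP x 0.
- have : \forall y \near x, 0 = y * ln y.
    by near=> y; rewrite ln0 ?mulr0// ltW//; near: y; exact: lt_nbhsl.
  by move/near_eq_cvg/cvg_trans; apply; rewrite ln0 ?mulr0 ?ltW//; exact: cvg_cst.
- by apply: continuousM; [exact: cvg_id|exact: continuous_ln].
- rewrite /continuous_at mul0r.
  apply/norm_cvg0P.
  apply: (@squeeze_cvgr _ _ _ _ (cst 0) (fun y => 2 * Num.sqrt y)).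
  + near=> y; rewrite normr_ge0/=.
    (* Left of 0 the function is identically 0, so the square-root bound is only needed for 0 < y <=
       1. *)
    have [y0|y0] := leP y 0.
      by rewrite ln0// mulr0 normr0 mulr_ge0// sqrtr_ge0.
    by rewrite norm_xlnx_le// ltW//=; near: y; exact: lt_le_nbhsl.
  + exact: cvg_cst.
  + rewrite -[X in _ --> X](mulr0 2) -[X in _ * X](@sqrtr0 R).
    apply: cvgMr; exact: realfun.sqrt_continuous.
Unshelve. all: by end_near. Qed.

End xlnx.

(** * Convexity of functions of a tensor *)

Section convex.
Variables (R : realType) (I : finType).
Implicit Types (D : set (I -> R)) (f g : (I -> R) -> R).

(** Here and in the next lemma, explicit weights p and q replace the bundled weight of the unit
    interval, which reduces convexity to entrywise real arithmetic. *)
Lemma convex_set_of_mix D :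
  (forall p q x y, 0 <= p -> 0 <= q -> p + q = 1 -> D x -> D y ->
    D (fun i => p * x i + q * y i)) ->
  @convex_set R (I -> R^o) D.
Proof.
move=> h x y t /set_mem Dx /set_mem Dy; apply/mem_set.
by apply: (h t%:num (1 - t%:num)) => //; rewrite ?subr_ge0// addrC subrK.
Qed.

Lemma convex_function_of_mix D f :
  (forall p q x y, 0 <= p -> 0 <= q -> p + q = 1 -> D x -> D y ->
    f (fun i => p * x i + q * y i) <= p * f x + q * f y) ->
  @convex_function R (I -> R^o) D f.
Proof.
move=> h t x y /set_mem Dx /set_mem Dy.
by apply: (h t%:num (1 - t%:num)) => //; rewrite ?subr_ge0// addrC subrK.
Qed.

Lemma convex_onD D f g : convex_on D f -> convex_on D g ->
  convex_on D (fun x => f x + g x).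
Proof.
move=> [cD cf] [_ cg]; split=> // t x y Dx Dy.
apply: le_trans (lerD (cf t x y Dx Dy) (cg t x y Dx Dy)) _.
by rewrite !convRE !mulrDr addrACA.
Qed.

Lemma convex_onZ D f (c : R) : 0 <= c -> convex_on D f ->
  convex_on D (fun x => c * f x).
Proof.
move=> c0 [cD cf]; split=> // t x y Dx Dy.
apply: le_trans (ler_wpM2l c0 (cf t x y Dx Dy)) _.
by rewrite !convRE mulrDr !(mulrCA c).
Qed.


(** Convexity of [D] is a separate hypothesis because [J] may be empty. *)
Lemma convex_on_sum (J : finType) D (F : J -> (I -> R) -> R) :
  @convex_set R (I -> R^o) D -> (forall j, convex_on D (F j)) ->
  convex_on D (fun x => \sum_j F j x).
Proof.
move=> cD cF; split=> // t x y Dx Dy.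
rewrite convRE !mulr_sumr -big_split/=; apply: ler_sum => j _.
by case: (cF j) => _ /(_ t x y Dx Dy); rewrite convRE.
Qed.

Lemma convex_on_inner D (C : I -> R) :
  @convex_set R (I -> R^o) D -> convex_on D (inner C).
Proof.
move=> cD; split=> //; apply: convex_function_of_mix => p q x y _ _ _ _ _.
rewrite /inner !mulr_sumr -big_split/= le_eqVlt; apply/orP; left; apply/eqP.
by apply: eq_bigr => i _; ring.
Qed.

Lemma convex_set_prob_tensor : @convex_set R (I -> R^o) (prob_tensor R I).
Proof.
apply: convex_set_of_mix => p q x y p0 q0 pq1 [x0 x1] [y0 y1]; split.
  by move=> i; rewrite addr_ge0// mulr_ge0.
by rewrite big_split/= -!mulr_sumr x1 y1 !mulr1.
Qed.

Lemma convex_on_negentropy : convex_on (prob_tensor R I) (@negentropy R I).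
Proof.
split; first exact: convex_set_prob_tensor.
apply: convex_function_of_mix => p q x y p0 q0 pq1 [x0 _] [y0 _].
rewrite /negentropy !mulr_sumr -big_split/=; apply: ler_sum => i _.
exact: xlnx_convex.
Qed.

End convex.

(** * Marginals and their negative entropy *)

Section marginal.
Variables (R : realType) (N : nat) (a : 'I_N -> nat) (t : seq 'I_N).
Implicit Types P : midx a -> R.

(** Group the multi-indices by the fibres of [subidx t]. Taking f = 1 gives the total mass, and f =
    ln of the marginal gives its negative entropy. *)
Lemma sum_marginal P (f : midx (subshape a t) -> R) :
  \sum_j marginal t P j * f j = \sum_i P i * f (subidx t i).
Proof.
rewrite [RHS](partition_big (subidx t) xpredT)//=; apply: eq_bigr => j _.
by rewrite mulr_suml; apply: eq_bigr => i /eqP ->.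
Qed.

Lemma le_marginal P i : (forall i, 0 <= P i) ->
  P i <= marginal t P (subidx t i).
Proof. by move=> P0; rewrite /marginal (bigD1 i)//= lerDl sumr_ge0. Qed.

Lemma prob_tensor_marginal P : prob_tensor R (midx a) P ->
  prob_tensor R (midx (subshape a t)) (marginal t P).
Proof.
move=> [P0 P1]; split; first by move=> j; exact: sumr_ge0.
have := sum_marginal P (fun=> 1); under eq_bigr do rewrite mulr1.
by move=> ->; under eq_bigr do rewrite mulr1.
Qed.

Lemma convex_on_negentropy_marginal :
  convex_on (prob_tensor R (midx a)) (fun P => negentropy (marginal t P)).
Proof.
split; first exact: convex_set_prob_tensor.
apply: convex_function_of_mix => p q x y p0 q0 pq1 Dx Dy.
rewrite /negentropy !mulr_sumr -big_split/=; apply: ler_sum => j _.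
(* Only the marginal of the mixture is unfolded: it is the mixture of the marginals. *)
rewrite {1 2}/marginal big_split/= -!mulr_sumr.
by apply: xlnx_convex => //; exact: (prob_tensor_marginal _).1.
Qed.

(** Continuity holds on the whole space: each entry of the marginal is a finite sum of coordinate
    projections, and x ln x is continuous on the whole line. *)
Lemma continuous_on_negentropy_marginal :
  continuous_on (prob_tensor R (midx a)) (fun P => negentropy (marginal t P)).
Proof.
apply: continuous_subspaceT; apply: continuous_big => [|j _].
  exact: add_continuous.
move=> x; apply: (@continuous_comp {ptws midx a -> R} R R
  (fun P => marginal t P j) (fun r => r * ln r)); last exact: continuous_xlnx.
apply: continuous_big => [|i _]; first exact: add_continuous.
exact: proj_continuous.
Qed.

End marginal.

(** Stated for nonnegative tensors so that it applies directly to members of [couplings mu] as well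
    as to probability tensors. *)
Lemma KL_marginal_prod (R : realType) (N M : nat) (a : 'I_N -> nat)
    (T : M.-tuple (seq 'I_N)) (P : midx a -> R) :
  (forall i, 0 <= P i) ->
  KL P (marginal_prod T P)
    = (negentropy P - \sum_(m < M) block_negentropy T m P)%:E.
Proof.
move=> P0; have le_marg i m := le_marginal (tnth T m) i P0.
rewrite /KL; case: asboolP => [_|]; last first.
  (* A zero entry of the product has a zero factor, and that factor bounds P i from above. *)
  case=> i /eqP; rewrite prodf_seq_eq0 => /hasP[/= m _ /eqP mi0].
  by apply: le_anti; rewrite P0 -[X in _ <= X]mi0 le_marg.
(* Rewrite the block entropies as sums over full multi-indices, so that the two sides can be
   compared term by term. *)
congr (_%:E); under [X in _ - X]eq_bigr do
  rewrite /block_negentropy /negentropy sum_marginal.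
rewrite exchange_big/= -sumrB; apply: eq_bigr => i _; rewrite -mulr_sumr -mulrBr.
have := P0 i; rewrite le_eqVlt => /predU1P[<-|Pi0]; first by rewrite !mul0r.
have marg_gt0 m := lt_le_trans Pi0 (le_marg i m).
congr (_ * _); rewrite ln_div ?posrE//; last exact: prodr_gt0.
congr (_ - _).
(* The induction also carries positivity of the partial products, which splitting the logarithm
   requires. *)
suff [] : 0 < \prod_(m < M) marginal (tnth T m) P (subidx (tnth T m) i) /\
  ln (\prod_(m < M) marginal (tnth T m) P (subidx (tnth T m) i))
  = \sum_(m < M) ln (marginal (tnth T m) P (subidx (tnth T m) i)) by [].
apply: (big_rec2 (fun x y => 0 < x /\ ln x = y)) => [|m y x _ [x0 <-]].
  by rewrite ln1.
by rewrite lnM ?posrE// mulr_gt0.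
Qed.

Lemma convex_set_couplings (R : realType) (N : nat) (a : 'I_N -> nat)
    (mu : forall n : 'I_N, 'I_(a n) -> R) :
  @convex_set R (midx a -> R^o) (couplings mu).
Proof.
apply: convex_set_of_mix => p q x y p0 q0 pq1 [x0 xmu] [y0 ymu]; split.
  by move=> i; rewrite addr_ge0// mulr_ge0.
move=> n j; rewrite /marginal1 big_split/= -!mulr_sumr.
by rewrite [X in p * X]xmu [X in q * X]ymu -mulrDl pq1 mul1r.
Qed.

Theorem mainTheorem1 (R : realType) (N M : nat) (hM : (2 <= M)%N)
    (hMN : (M <= N)%N) (a : 'I_N -> nat) (ha : forall n, (1 <= a n)%N)
    (T : M.-tuple (seq 'I_N)) (hT : tuple_partition T) :
  [/\ forall P : midx a -> R, prob_tensor R (midx a) P ->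
        KL P (marginal_prod T P)
          = (negentropy P - \sum_(m < M) block_negentropy T m P)%:E,
      forall m : 'I_M,
        continuous_on (prob_tensor R (midx a)) (block_negentropy T m)
        /\ convex_on (prob_tensor R (midx a)) (block_negentropy T m) &
      forall (eps : R) (C : midx a -> R) (mu : forall n : 'I_N, 'I_(a n) -> R),
        0 <= eps -> (forall n, prob_tensor R 'I_(a n) (mu n)) ->
        let g (P : midx a -> R) := inner C P + eps * negentropy P in
        let h (P : midx a -> R) :=
          eps * \sum_(m < M) block_negentropy T m P in
        let objective (P : midx a -> R) :=
          ((inner C P)%:E + eps%:E * KL P (marginal_prod T P))%E in
        [/\ ereal_inf [set objective P | P in couplings mu]
              = ereal_inf [set (g P - h P)%:E | P in couplings mu],
            @convex_set R (midx a -> R^o) (couplings mu),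
            convex_on (prob_tensor R (midx a)) g,
            convex_on (prob_tensor R (midx a)) h &
            forall P, couplings mu P -> objective P = (g P - h P)%:E]].
Proof.
have objE (eps : R) (C : midx a -> R) P : (forall i, 0 <= P i) ->
    ((inner C P)%:E + eps%:E * KL P (marginal_prod T P))%E =
    (inner C P + eps * negentropy P
      - eps * \sum_(m < M) block_negentropy T m P)%:E.
  by move=> P0; rewrite KL_marginal_prod// -EFinM -EFinD mulrBr addrA.
split=> [P [P0 _]|m|eps C mu eps0 _ g h objective].
- exact: KL_marginal_prod.
- split; first exact: continuous_on_negentropy_marginal.
  exact: convex_on_negentropy_marginal.
have cS := @convex_set_prob_tensor R (midx a).
split=> [||||P [P0 _]]; last exact: objE.
(* The objectives agree pointwise on [couplings mu], so their images have the same infimum. *)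
- by congr ereal_inf; apply: eq_imagel => P [P0 _]; exact: objE.
- exact: convex_set_couplings.
- apply: convex_onD; first exact: convex_on_inner.
  by apply: convex_onZ => //; exact: convex_on_negentropy.
- apply: convex_onZ => //; apply: convex_on_sum => // m.
  exact: convex_on_negentropy_marginal.
Qed.
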